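(* Let $d\ge 2$, let $\Omega\subset\mathbb R^d$ be a domain and let $Y=Y(\Omega)$ be a dual Banach space of distributions on $\Omega$ (in the sense described in the context). Assume there is $\gamma>0$ such that for every $g\in Y$ there exists a vector field $\mathbf u\in L^\infty(\Omega)$ with $\operatorname{div}\mathbf u=g$ and $\|\mathbf u\|_{L^\infty}\le\gamma\|g\|_Y$. Let $\lambda>\gamma$ and $\rho:=\gamma/\lambda<1$. Given $f\in Y$, set $r_0:=f$ and for $j\ge1$ let iteratively $\mathbf u_j\in L^\infty(\Omega)$ be a minimizer of $$\mathcal V_j(\mathbf u)=\|\mathbf u\|_{L^\infty}+\lambda\|r_{j-1}-\operatorname{div}\mathbf u\|_Y,\qquad\text{and}\qquad r_j:=r_{j-1}-\operatorname{div}\mathbf u_j .$$ Then for all $j\ge1$, $$\|r_j\|_Y\le\rho^j\|f\|_Y,\qquad \|\mathbf u_j\|_{L^\infty}\le\gamma\rho^{j-1}\|f\|_Y,$$ and the series $\mathbf u_1+\mathbf u_2+\cdots+\mathbf u_j+\cdots$ converges to a uniformly bounded $\mathbf u$ satisfying $\operatorname{div}\mathbf u=f$ and $$\|\mathbf u\|_{L^\infty}\le\frac{\gamma}{1-\rho}\|f\|_Y .$$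
   Context: $Y=Z'$ is a dual space of distributions on $\Omega$, with $\|v\|_Y=\sup\{\langle v,\varphi\rangle_{Y,Z}:\varphi\in\mathcal D(\Omega),\ \|\varphi\|_Z\le1\}$, where $\mathcal D(\Omega)$ is the space of test functions; this guarantees that the minimizers exist. The functionals are minimized over vector fields in $L^\infty(\Omega)$ and take the value $+\infty$ when $\operatorname{div}\mathbf u\notin Y$. $\|\mathbf u\|_{L^\infty}=\operatorname{ess\,sup}_x|\mathbf u(x)|_2$, with $|\cdot|_2$ the Euclidean norm; the divergence is distributional, and the series converges in $L^\infty(\Omega)$. *)

(* Defs.v *)
From HB Require Import structures.
From mathcomp Require Import all_boot all_order all_algebra.
From mathcomp Require Import all_classical all_reals all_analysis.
From mathcomp Require Import ess_sup_inf.

Set Implicit Arguments.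
Unset Strict Implicit.
Unset Printing Implicit Defensive.

Import Order.TTheory GRing.Theory Num.Theory.
Import numFieldNormedType.Exports.

Local Open Scope classical_set_scope.
Local Open Scope ring_scope.

(* The σ-algebra on [T^n] is generated by the coordinates; for [T = R] it is
   the Borel σ-algebra.  The Lebesgue measure on [R^n] is then the iterated
   product of the one-dimensional one (see [lebesgue_rV_box]).                *)

Definition measure_rV_display : measure_display -> measure_display.
Proof. exact. Qed.

Section measurable_rV.
Context {d} {T : measurableType d}.
Variable n : nat.

Let coors : 'I_n -> 'rV[T]_n -> T := fun i v => v ord0 i.

Let rV_set0 : g_sigma_preimage coors set0.
Proof. exact: sigma_algebra0. Qed.

Let rV_setC A : g_sigma_preimage coors A -> g_sigma_preimage coors (~` A).
Proof. exact: sigma_algebraC. Qed.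

Let rV_bigcup (F : _^nat) : (forall i, g_sigma_preimage coors (F i)) ->
  g_sigma_preimage coors (\bigcup_i (F i)).
Proof. exact: sigma_algebra_bigcup. Qed.

HB.instance Definition _ := @isMeasurable.Build (measure_rV_display d)
  'rV[T]_n (g_sigma_preimage coors) rV_set0 rV_setC rV_bigcup.

End measurable_rV.

Lemma measurable_coord d (T : measurableType d) n (i : 'I_n) :
  measurable_fun [set: 'rV[T]_n] (fun v => v ord0 i).
Proof.
move=> _ Y mY; rewrite setTI; apply: sub_sigma_algebra => /=.
rewrite -bigcup_seq/=; exists i => /=; first by rewrite mem_index_enum.
by exists Y => //; rewrite setTI.
Qed.

Lemma measurable_fun_rVP d1 d2 (T1 : measurableType d1)
    (T2 : measurableType d2) n (f : T1 -> 'rV[T2]_n) :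
  (forall i, measurable_fun setT (fun x => f x ord0 i)) ->
  measurable_fun setT f.
Proof.
move=> mf; apply: (@measurability _ _ _ _ setT f
  (\big[setU/set0]_(i < n) preimage_set_system setT
     (fun v : 'rV[T2]_n => v ord0 i) measurable)) => //.
move=> _ [C + <-]; rewrite -bigcup_seq => -[i _ [B mB <-]].
by rewrite setTI; exact: mf.
Qed.

Section lebesgue_rV.
Variable R : realType.

Section cons.
Context (n : nat) (mu : {sigma_finite_measure set 'rV[R]_n -> \bar R}).

Definition rV_cons (z : R * 'rV[R]_n) : 'rV[R]_n.+1 :=
  \row_i oapp (z.2 ord0) z.1 (unlift ord0 i).

Definition rV_uncons (v : 'rV[R]_n.+1) : R * 'rV[R]_n :=
  (v ord0 ord0, \row_i v ord0 (lift ord0 i)).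

Lemma rV_cons0 z : rV_cons z ord0 ord0 = z.1.
Proof. by rewrite mxE unlift_none. Qed.

Lemma rV_consS z i : rV_cons z ord0 (lift ord0 i) = z.2 ord0 i.
Proof. by rewrite mxE liftK. Qed.

Lemma rV_consK : cancel rV_cons rV_uncons.
Proof.
move=> [x v]; rewrite /rV_uncons rV_cons0; congr pair.
by apply/rowP => i; rewrite mxE rV_consS.
Qed.

Lemma measurable_rV_cons : measurable_fun setT rV_cons.
Proof.
apply: measurable_fun_rVP => i; case: (unliftP ord0 i) => [j|] ->.
- rewrite (_ : (fun _ => _) = (fun v : 'rV[R]_n => v ord0 j) \o snd).
    exact: measurableT_comp (measurable_coord _) measurable_snd.
  by apply/funext => z; rewrite /= rV_consS.
- rewrite (_ : (fun _ => _) = fst) //.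
  by apply/funext => z; rewrite rV_cons0.
Qed.

Lemma measurable_rV_uncons : measurable_fun setT rV_uncons.
Proof.
apply/measurable_fun_pairP; split; first exact: measurable_coord.
apply: measurable_fun_rVP => i.
rewrite (_ : (fun _ => _) = fun v : 'rV[R]_n.+1 => v ord0 (lift ord0 i)).
  exact: measurable_coord.
by apply/funext => v; rewrite /= mxE.
Qed.

Definition lebesgue_cons : set 'rV[R]_n.+1 -> \bar R :=
  pushforward (lebesgue_measure \x mu)%E rV_cons.

HB.instance Definition _ := Measure.copy lebesgue_cons
  (measure_function_pushforward__canonical__measure_function_Measure
    (lebesgue_measure \x mu)%E measurable_rV_cons).

Lemma lebesgue_consE (A : set R) (B : set 'rV[R]_n) :
  measurable A -> measurable B ->
  lebesgue_cons [set v | A (v ord0 ord0) /\ B (\row_i v ord0 (lift ord0 i))]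
  = (lebesgue_measure A * mu B)%E.
Proof.
move=> mA mB; rewrite /lebesgue_cons /pushforward -product_measure1E//.
rewrite (_ : rV_cons @^-1` _ = A `*` B)//; apply/seteqP; split=> -[x v] /=;
  by have [-> ->] := rV_consK (x, v).
Qed.

Let sigma_finite_lebesgue_cons : sigma_finite setT lebesgue_cons.
Proof.
have /sigma_finiteP[F [TF ndF Foo]] := sigma_finiteT (@lebesgue_measure R).
have /sigma_finiteP[G [TG ndG Goo]] := sigma_finiteT mu.
exists (fun k => rV_uncons @^-1` (F k `*` G k)).
  rewrite -preimage_bigcup; apply/seteqP; split=> // v _.
  have : setT (rV_uncons v).1 by [].
  have : setT (rV_uncons v).2 by [].
  rewrite TF TG => -[k _ Gkv] [l _ Flv]; exists (maxn l k) => //; split.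
  - by move: Flv; exact/subsetPset/ndF/leq_maxl.
  - by move: Gkv; exact/subsetPset/ndG/leq_maxr.
move=> k; have [mF Fk] := Foo k; have [mG Gk] := Goo k; split.
  rewrite -[X in measurable X]setTI; apply: measurable_rV_uncons => //.
  exact: measurableX.
rewrite lebesgue_consE// lte_mul_pinfty// ge0_fin_numE//.
Qed.

HB.instance Definition _ := Measure_isSigmaFinite.Build _ _ _ lebesgue_cons
  sigma_finite_lebesgue_cons.

End cons.

Fixpoint lebesgue_rV n : {sigma_finite_measure set 'rV[R]_n -> \bar R} :=
  if n is n'.+1 then lebesgue_cons (lebesgue_rV n') else \d_ (0 : 'rV[R]_0).

Lemma lebesgue_rV_box n (A : 'I_n -> set R) : (forall i, measurable (A i)) ->
  lebesgue_rV n [set v | forall i, A i (v ord0 i)] =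
  (\prod_(i < n) lebesgue_measure (A i))%E.
Proof.
elim: n A => [|n IHn] A mA.
  by rewrite big_ord0 /= diracE mem_set// => -[].
rewrite big_ord_recl -IHn; last by move=> i; exact: mA.
have mB : measurable [set v : 'rV[R]_n | forall i, A (lift ord0 i) (v ord0 i)].
  rewrite (_ : mkset _ = \bigcap_(i in [set: 'I_n])
    ((fun v : 'rV[R]_n => v ord0 i) @^-1` A (lift ord0 i))).
    apply: fin_bigcap_measurable => // i _.
    by rewrite -[X in measurable X]setTI; exact: measurable_coord.
  by apply/seteqP; split=> v /= Av i => [_|]; apply: Av.
rewrite -lebesgue_consE//.
congr (lebesgue_cons _ _); apply/seteqP; split=> v /= => [Av|[Av0 Av] i].
  by split=> // i; rewrite mxE; exact: Av.
by case: (unliftP ord0 i) => [j|] -> //; have := Av j; rewrite mxE.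
Qed.

End lebesgue_rV.

Section test_functions.
Variables (R : realType) (d : nat).
Implicit Types (f g : 'rV[R]_d -> R) (s : seq 'I_d) (Omega : set 'rV[R]_d).

Definition partial (i : 'I_d) f : 'rV[R]_d -> R :=
  fun x => 'D_(delta_mx ord0 i) f x.

Definition partials s f : 'rV[R]_d -> R := foldr partial f s.

Definition smooth f : Prop := forall s, continuous (partials s f) /\
  forall i x, derivable (partials s f) x (delta_mx ord0 i).

Definition supp f : set 'rV[R]_d := closure [set x | f x != 0].

Definition test_function Omega f : Prop :=
  [/\ smooth f, compact (supp f) & supp f `<=` Omega].

Lemma partials_lin (a : R) f g s : smooth f -> smooth g ->
  partials s (a *: f + g) = a *: partials s f + partials s g.
Proof.
move=> sf sg; elim: s => //= i s ->; apply/funext => x.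
have df := (sf s).2 i x; have dg := (sg s).2 i x.
by rewrite /partial deriveD ?deriveZ//; exact: derivableZ.
Qed.

Definition test_pred Omega : {pred ('rV[R]_d -> R)} :=
  mem [set f | test_function Omega f].

Lemma test_pred_submod_closed Omega : submod_closed (test_pred Omega).
Proof.
split=> [|a f g /set_mem[sf cf fO] /set_mem[sg cg gO]]; apply/mem_set.
  have p0 s : partials s 0 = 0.
    elim: s => //= i s ->; apply/funext => x.
    by rewrite /partial -[0]/(cst 0) derive_cst.
  have supp0 : supp 0 = set0.
    rewrite /supp (_ : mkset _ = set0) ?closure0//.
    by apply/seteqP; split=> x //=; rewrite eqxx.
  rewrite /= /test_function supp0; split; [|exact: compact0|by []].
  move=> s; rewrite p0; split; first exact: cst_continuous.
  by move=> i x; exact: derivable_cst.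
have sub : supp (a *: f + g) `<=` supp f `|` supp g.
  rewrite /supp -closureU; apply: closure_subset => x /=.
  move=> abx; have [fx|fx] := eqVneq (f x) 0; last by left.
  right; apply: contraNN abx => /eqP gx.
  by rewrite -[(_ + _) x]/(a * f x + g x) fx gx mulr0 addr0.
split; last by move=> x /sub[/fO|/gO].
- move=> s; rewrite partials_lin//; split.
    move=> x; apply: continuousD; last exact: (sg s).1.
    by apply: continuousZr; exact: (sf s).1.
  move=> i x; apply: derivableD; last exact: (sg s).2.
  by apply: derivableZ; exact: (sf s).2.
- apply: subclosed_compact sub; first exact: closed_closure.
  exact: compactU.
Qed.

End test_functions.

Record testfun (R : realType) (d : nat) (Omega : set 'rV[R]_d) := TestFun {
  testfun_val :> 'rV[R]_d -> R ;
  testfunP : testfun_val \in test_pred Omega }.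

Section testfun_lmodType.
Variables (R : realType) (d : nat) (Omega : set 'rV[R]_d).

HB.instance Definition _ := GRing.isSubmodClosed.Build _ _
  (test_pred Omega) (test_pred_submod_closed Omega).

HB.instance Definition _ := [isSub for @testfun_val R d Omega].
HB.instance Definition _ := [Choice of testfun Omega by <:].
HB.instance Definition _ := [SubChoice_isSubLmodule of testfun Omega by <:].

End testfun_lmodType.

Section distributions.
Variables (R : realType) (d : nat) (Omega : set 'rV[R]_d).

Definition Ck_norm (k : nat) (phi : testfun Omega) : R :=
  sup [set r | exists s x, (size s <= k)%N /\ r = `|partials s phi x|].

(* For linear maps this is continuity for the usual (inductive limit)
   topology of D(Omega).                                                      *)
Definition test_continuous (V : normedModType R) (T : testfun Omega -> V) :=
  forall K : set 'rV[R]_d, compact K -> K `<=` Omega ->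
  exists (C : R) (k : nat), forall phi : testfun Omega,
    supp phi `<=` K -> `|T phi| <= C * Ck_norm k phi.

Definition distribution (T : testfun Omega -> R^o) : Prop :=
  linear T /\ test_continuous T.

End distributions.

Section vector_fields.
Variables (R : realType) (d : nat) (Omega : set 'rV[R]_d).
Implicit Types u : 'rV[R]_d -> 'rV[R]_d.

Definition euclidean (x : 'rV[R]_d) : R := Num.sqrt (\sum_i x ord0 i ^+ 2).

(* Vector fields on Omega are functions on the whole space of which only the
   values on Omega matter; [\_ Omega] extends |u| by 0 outside Omega, which
   does not affect the essential supremum of a nonnegative function.          *)
Definition Linfty_norm u : \bar R :=
  ess_sup (lebesgue_rV R d) (EFin \o ((euclidean \o u) \_ Omega)).

Definition Linfty : set ('rV[R]_d -> 'rV[R]_d) :=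
  [set u | measurable_fun Omega u /\ (Linfty_norm u < +oo)%E].

Definition div u : testfun Omega -> R := fun phi =>
  - \int[lebesgue_rV R d]_(x in Omega)
      \sum_(i < d) u x ord0 i * partial i phi x.

End vector_fields.

Section dual_space.
Variables (R : realType) (d : nat) (Omega : set 'rV[R]_d).
Variables (Z : normedModType R) (iota : {linear testfun Omega -> Z}).

(* [iota] realizes D(Omega) as a dense subspace of Z, with continuous
   inclusion; this is what makes the elements of Z' distributions.            *)
Definition test_embedding : Prop :=
  [/\ injective iota, test_continuous iota & dense (range iota)].

Definition dual : set (testfun Omega -> R) :=
  [set v | exists2 l : {linear Z -> R^o}, continuous l & v = l \o iota].

Definition dual_norm (v : testfun Omega -> R) : \bar R :=
  ereal_sup [set (v phi)%:E | phi in [set phi | `|iota phi| <= 1]].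

Lemma dual_distribution v : test_embedding -> dual v -> distribution v.
Proof.
move=> [_ ci _] [l cl ->]; split.
  by move=> a x y /=; rewrite !linearP.
move=> K cK KO; have [C [k iC]] := ci K cK KO.
have /linear_boundedP/pinfty_ex_gt0[M M0 lM] :=
  continuous_linear_bounded 0 (cl 0).
exists (M * C), k => phi /iC phiC /=.
by rewrite -mulrA (le_trans (lM _))// ler_wpM2l// ltW.
Qed.

Local Open Scope ereal_scope.

Definition functional (lambda : R) (r : testfun Omega -> R)
    (u : 'rV[R]_d -> 'rV[R]_d) : \bar R :=
  if `[< dual (div u) >]
  then Linfty_norm Omega u + lambda%:E * dual_norm (r \- div u)%R
  else +oo.

Definition minimizer (V : ('rV[R]_d -> 'rV[R]_d) -> \bar R)
    (u : 'rV[R]_d -> 'rV[R]_d) : Prop :=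
  Linfty Omega u /\ forall w, Linfty Omega w -> V u <= V w.

End dual_space.

(* Main.v *)
(* A single step of the hierarchical decomposition contracts the residual:
   comparing u_j with a solution w of div w = r_(j-1), |w| <= gamma |r_(j-1)|,
   gives |u_j| + lambda |r_j| <= gamma |r_(j-1)|.  The fields u_j are therefore
   dominated by a geometric series, so their sum converges essentially uniformly
   to some U.  For a fixed test function phi the divergence is continuous for
   the sup norm, because grad phi is integrable, so the telescoping identity
   div (u_1 + ... + u_n) = f - r_n passes to the limit. *)

Require Import Defs.
From mathcomp Require Import all_boot all_order all_algebra.
From mathcomp Require Import all_classical all_reals all_analysis.
From mathcomp Require Import ess_sup_inf measurable_realfun ring lra.

Set Implicit Arguments.
Unset Strict Implicit.
Unset Printing Implicit Defensive.

Import Order.TTheory GRing.Theory Num.Theory.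
Import numFieldNormedType.Exports.

Local Open Scope classical_set_scope.
Local Open Scope ring_scope.

(** * The Euclidean norm on row vectors *)

Section euclidean_norm.
Variables (R : realType) (d : nat).
Implicit Types x y : 'rV[R]_d.

Lemma euclidean_ge0 x : 0 <= euclidean x.
Proof. exact: sqrtr_ge0. Qed.

Lemma sqr_euclidean x : euclidean x ^+ 2 = \sum_i x ord0 i ^+ 2.
Proof. by rewrite sqr_sqrtr// sumr_ge0// => i _; exact: sqr_ge0. Qed.

Lemma euclidean_le x (c : R) : 0 <= c ->
  (euclidean x <= c) = (\sum_i x ord0 i ^+ 2 <= c ^+ 2).
Proof.
by move=> c0; rewrite -sqr_euclidean ler_pXn2r// nnegrE euclidean_ge0.
Qed.

Lemma euclidean0 : euclidean (0 : 'rV[R]_d) = 0.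
Proof.
by rewrite /euclidean big1 ?sqrtr0// => i _; rewrite mxE expr0n.
Qed.

Lemma euclideanN x : euclidean (- x) = euclidean x.
Proof.
by rewrite /euclidean; congr Num.sqrt; apply: eq_bigr => i _; rewrite mxE sqrrN.
Qed.

Lemma le_coord_euclidean x i : `|x ord0 i| <= euclidean x.
Proof.
rewrite -sqrtr_sqr ler_wsqrtr// (bigD1 i)//= lerDl.
by apply: sumr_ge0 => j _; exact: sqr_ge0.
Qed.

Lemma euclidean_eq0 x : euclidean x = 0 -> x = 0.
Proof.
move=> x0; apply/rowP => i; rewrite mxE; apply/normr0_eq0/le_anti.
by rewrite normr_ge0 -{1}x0 le_coord_euclidean.
Qed.

Lemma euclideanD x y : euclidean (x + y) <= euclidean x + euclidean y.
Proof.
have [/euclidean_eq0->|x0] := eqVneq (euclidean x) 0.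
  by rewrite add0r euclidean0 add0r.
have [/euclidean_eq0->|y0] := eqVneq (euclidean y) 0.
  by rewrite addr0 euclidean0 addr0.
set a := euclidean x in x0 *; set b := euclidean y in y0 *.
have a0 : 0 < a by rewrite lt_def x0 euclidean_ge0.
have b0 : 0 < b by rewrite lt_def y0 euclidean_ge0.
rewrite euclidean_le; last by rewrite addr_ge0 ?ltW.
(* AM-GM: 2 s t <= (b / a) s^2 + (a / b) t^2, summed over the coordinates *)
have H i : (x + y) ord0 i ^+ 2 <=
    (1 + b / a) * x ord0 i ^+ 2 + (1 + a / b) * y ord0 i ^+ 2.
  rewrite mxE -subr_ge0.
  rewrite (_ : _ - _ =
    (b * x ord0 i - a * y ord0 i) ^+ 2 / (a * b)); last by field; rewrite x0 y0.
  by rewrite divr_ge0 ?sqr_ge0// mulr_ge0 ?ltW.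
apply: le_trans (ler_sum _ (fun i _ => H i)) _.
(* Summed up, the bound is (1 + b/a) a^2 + (1 + a/b) b^2, which equals (a + b)^2. *)
rewrite big_split/= -!mulr_sumr -!sqr_euclidean -/a -/b.
rewrite le_eqVlt; apply/orP; left; apply/eqP; field; exact/andP.
Qed.

End euclidean_norm.

(** * Borel sets and Lebesgue measure in R^d *)

Section rV_measurability.
Variables (R : realType) (d : nat).
Implicit Types A : set 'rV[R]_d.

Lemma measurable_rV_box (B : 'I_d -> set R) : (forall i, measurable (B i)) ->
  measurable [set v : 'rV[R]_d | forall i, B i (v ord0 i)].
Proof.
move=> mB; rewrite (_ : mkset _ = \bigcap_(i in [set: 'I_d])
  ((fun v : 'rV[R]_d => v ord0 i) @^-1` B i)).
  apply: fin_bigcap_measurable => // i _.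
  by rewrite -[X in measurable X]setTI; exact: measurable_coord.
by apply/seteqP; split=> v /= Bv i => [_|]; apply: Bv.
Qed.

(** The sigma-algebra is generated by the coordinates, not by the topology; an open set belongs to
    it as the union of the countably many rational boxes that it contains. *)
Lemma open_measurable_rV A : open A -> measurable A.
Proof.
move=> oA; pose box (p : 'rV[rat]_d * 'rV[rat]_d) :=
  [set v : 'rV[R]_d | forall i, `]ratr (p.1 ord0 i), ratr (p.2 ord0 i)[%classic
     (v ord0 i)].
have -> : A = \bigcup_(p in [set p | box p `<=` A]) box p.
  apply/seteqP; split=> [x Ax|x [p pA]]; last exact: pA.
  have /nbhs_ballP[e /= e0 xeA] : nbhs x A by exact: open_nbhs_nbhs.
  (* Rational corners are chosen within [e] of [x] on either side, so the box lies in the ball,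
     which is a cube. *)
  have /choice[p pP] i : exists q, ratr q \in `]x ord0 i - e, x ord0 i[.
    by apply: rat_in_itvoo; rewrite ltrBlDr ltrDl.
  have /choice[q qP] i : exists q, ratr q \in `]x ord0 i, x ord0 i + e[.
    by apply: rat_in_itvoo; rewrite ltrDl.
  exists (\row_i p i, \row_i q i) => [v /= pqv|i]/=; last first.
    have := pP i; have := qP i; rewrite !mxE !in_itv/=.
    by move=> /andP[-> _] /andP[_ ->].
  apply: xeA; split=> // j i; rewrite ord1 /ball/=.
  have := pP i; have := qP i; have := pqv i; rewrite /= !mxE !in_itv/=.
  rewrite ltr_norml => /andP[? ?] /andP[? ?] /andP[? ?]; apply/andP; split; lra.
rewrite bigcup_mkcond; apply: (@countable_bigcupT_measurable _ _
  ('rV[rat]_d * 'rV[rat]_d)%type) => [|p].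
  exact: countableP.
case: ifP => // _; apply: (@measurable_rV_box (fun i =>
  `]ratr (p.1 ord0 i), ratr (p.2 ord0 i)[%classic)) => i.
  exact: measurable_itv.
Qed.

Lemma continuous_measurable_rV (g : 'rV[R]_d -> R) :
  continuous g -> measurable_fun setT g.
Proof.
move=> /continuousP cg; apply: (measurability _ (RGenOpens.measurableE R)).
move=> _ [_ [a [b ->] <-]]; rewrite setTI; apply: open_measurable_rV.
exact/cg/interval_open.
Qed.

(** For the zero measure an essential supremum would be -oo; positivity of the total mass is what
    makes [Linfty_norm] nonnegative. *)
Lemma lebesgue_rV_setT_gt0 : (0 < lebesgue_rV R d setT)%E.
Proof.
rewrite (_ : setT = [set v : 'rV[R]_d | forall i : 'I_d, setT (v ord0 i)]).
  rewrite (@lebesgue_rV_box _ _ (fun=> setT))//.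
  elim/big_ind: _ => // [*|i _]; first exact: mule_gt0.
  by rewrite -set_itvNyy lebesgue_measure_itv/= addye// ltry.
by apply/esym; rewrite -subTset.
Qed.

Lemma bounded_lebesgue_rV_lty (K : set 'rV[R]_d) : bounded_set K ->
  exists B, [/\ measurable B, K `<=` B & (lebesgue_rV R d B < +oo)%E].
Proof.
move=> /pinfty_ex_gt0[M M0 KM].
exists [set v : 'rV[R]_d | forall i : 'I_d, `[-M, M]%classic (v ord0 i)]; split.
- apply: (@measurable_rV_box (fun=> `[-M, M]%classic)) => i.
  exact: measurable_itv.
- move=> v /KM/= vM i; rewrite in_itv/= -ler_norml.
  apply: le_trans vM; rewrite [leRHS]/Num.norm /= mx_normrE.
  exact: (le_bigmax _ (fun ij => `|v ij.1 ij.2|) (ord0, i)).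
rewrite (@lebesgue_rV_box _ _ (fun=> `[-M, M]%classic)) => [|i]; last first.
  exact: measurable_itv.
rewrite -ge0_fin_numE; last by rewrite prode_ge0.
elim/big_ind: _ => // [*|i _]; first exact: fin_numM.
by rewrite lebesgue_measure_itv/=; case: ifP.
Qed.

End rV_measurability.

(** Extends [measurable_fun_rVP] to a domain [D], because fields are measurable on [Omega] only. *)
Lemma measurable_fun_rV d1 d2 (T1 : measurableType d1)
    (T2 : measurableType d2) n (D : set T1) (f : T1 -> 'rV[T2]_n) :
  (forall i, measurable_fun D (fun x => f x ord0 i)) -> measurable_fun D f.
Proof.
move=> mf mD; apply: (@measurability _ _ _ _ D f
  (\big[setU/set0]_(i < n) preimage_set_system setT
     (fun v : 'rV[T2]_n => v ord0 i) measurable)) => //.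
move=> _ [C + <-]; rewrite -bigcup_seq => -[i _ [B mB <-]].
rewrite setTI; exact: (mf i mD _ mB).
Qed.

(** * The essential supremum norm of vector fields *)

Section Linfty_norm_theory.
Variables (R : realType) (d : nat) (Omega : set 'rV[R]_d).
Implicit Types w : 'rV[R]_d -> 'rV[R]_d.
Local Notation mu := (lebesgue_rV R d).

(** Since [M] is nonnegative, the extension by 0 respects the bound outside [Omega], so only points
    of [Omega] count. *)
Lemma Linfty_norm_leP w (M : R) : 0 <= M ->
  (Linfty_norm Omega w <= M%:E)%E <->
  {ae mu, forall x, Omega x -> euclidean (w x) <= M}.
Proof.
move=> M0; split.
  move=> /ess_supP; apply: filterS => x /= + Ox.
  by rewrite patchE mem_set// lee_fin.
move=> wM; apply/ess_supP; apply: filterS wM => x /= wM.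
by rewrite patchE lee_fin; case: ifPn => // /set_mem/wM.
Qed.

Lemma Linfty_norm_ge0 w : (0 <= Linfty_norm Omega w)%E.
Proof.
apply: ess_sup_gee; first exact: lebesgue_rV_setT_gt0.
apply: aeW => x /=; rewrite patchE lee_fin; case: ifP => // _.
exact: euclidean_ge0.
Qed.

Lemma Linfty_norm_bound w : Linfty Omega w ->
  exists2 M, 0 <= M & (Linfty_norm Omega w <= M%:E)%E.
Proof.
move=> [_ wy]; have w0 := Linfty_norm_ge0 w.
exists (fine (Linfty_norm Omega w)); first exact: fine_ge0.
by rewrite fineK// ge0_fin_numE.
Qed.

Lemma Linfty_coord w i : Linfty Omega w ->
  measurable_fun Omega (fun x => w x ord0 i).
Proof. by move=> [mw _]; exact: measurableT_comp (measurable_coord i) mw. Qed.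

Lemma Linfty_norm0 : Linfty_norm Omega 0 = 0%E.
Proof.
apply/le_anti; rewrite Linfty_norm_ge0 andbT.
by apply/Linfty_norm_leP => //; apply: aeW => x _; rewrite euclidean0.
Qed.

Lemma Linfty0 : Linfty Omega 0.
Proof. by split; [exact: measurable_cst|rewrite Linfty_norm0]. Qed.

Lemma LinftyD v w : Linfty Omega v -> Linfty Omega w -> Linfty Omega (v + w).
Proof.
move=> lv lw; split.
  apply: measurable_fun_rV => i; under eq_fun do rewrite mxE.
  by apply: measurable_funD; exact: Linfty_coord.
have [M M0 /(Linfty_norm_leP _ M0) vM] := Linfty_norm_bound lv.
have [N N0 /(Linfty_norm_leP _ N0) wN] := Linfty_norm_bound lw.
apply: (@le_lt_trans _ _ (M + N)%:E); last exact: ltry.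
apply/Linfty_norm_leP; first exact: addr_ge0.
apply: filterS2 vM wN => x vM wN Ox.
by apply: le_trans (euclideanD _ _) _; rewrite lerD ?vM ?wN.
Qed.

Lemma Linfty_normN w : Linfty_norm Omega (- w) = Linfty_norm Omega w.
Proof.
by apply: eq_ess_sup; apply: aeW => x; rewrite /= !patchE/= euclideanN.
Qed.

Lemma LinftyN w : Linfty Omega w -> Linfty Omega (- w).
Proof.
move=> lw; split.
  apply: measurable_fun_rV => i; under eq_fun do rewrite mxE.
  by apply: measurableT_comp => //; exact: Linfty_coord.
by rewrite Linfty_normN; exact: lw.2.
Qed.

End Linfty_norm_theory.

(** * The distributional divergence of bounded fields *)

Section divergence.
Variables (R : realType) (d : nat) (Omega : set 'rV[R]_d).
Hypothesis Omega_open : open Omega.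
Implicit Types (w : 'rV[R]_d -> 'rV[R]_d) (phi : testfun Omega).
Local Notation mu := (lebesgue_rV R d).

Lemma continuous_partial phi i : continuous (partial i phi).
Proof. by have /set_mem[/(_ [:: i])[]] := testfunP phi. Qed.

(** The complement of the support is open, so [phi] coincides with the constant 0 near [x] and has
    the same derivative there. *)
Lemma partial_supp phi i x : ~ supp phi x -> partial i phi x = 0.
Proof.
move=> phix; rewrite /partial -(derive_cst (0 : R) x (delta_mx ord0 i)).
apply: near_eq_derive; near=> y; apply/eqP; apply: contrapT => /negP phiy.
suff : ~ supp phi y by apply; exact: subset_closure.
near: y; apply: open_nbhs_nbhs; split => //.
exact/closed_openC/closed_closure.
Unshelve. all: by end_near. Qed.

(** The derivative is continuous, hence bounded on the compact support, and it vanishes elsewhere.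
    It is therefore integrable on a cube of finite measure around the support, then on the whole
    space, then on [Omega]. *)
Lemma integrable_partial phi i : mu.-integrable Omega (EFin \o partial i phi).
Proof.
have /set_mem[_ cphi _] := testfunP phi.
have [B [mB phiB Boo]] := bounded_lebesgue_rV_lty (compact_bounded cphi).
have mp : measurable_fun setT (partial i phi).
  by apply: continuous_measurable_rV; exact: continuous_partial.
apply: (@integrableS _ _ _ _ setT) => //; first exact: open_measurable_rV.
have : mu.-integrable B (EFin \o partial i phi).
  apply: measurable_bounded_integrable => //; first exact: measurable_funS mp.
  have : compact (partial i phi @` supp phi).
    apply: continuous_compact => //; apply: continuous_subspaceT.
    exact: continuous_partial.
  (* The absolute value makes every [N] above the threshold nonnegative, which covers the points of
     [B] outside the support. *)
  move=> /compact_bounded[M [Mr HM]]; exists `|M|; split=> // N MN x Bx /=.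
  have [sx|/partial_supp->] := pselect (supp phi x).
    by apply: (HM N) => //; exact: le_lt_trans (ler_norm _) MN.
  by rewrite normr0 ltW// (le_lt_trans _ MN).
move=> /(integrable_mkcond _ mB).
rewrite (_ : _ \_ _ = EFin \o partial i phi)//.
apply/funext => x; rewrite patchE /=; case: ifPn => // /negP xB.
by rewrite partial_supp// => /phiB/mem_set.
Qed.

(** Almost everywhere on [Omega] the product is dominated by [M] times the absolute value of the
    derivative, where [M] bounds the norm of [w]. *)
Lemma integrable_div w phi i : Linfty Omega w ->
  mu.-integrable Omega (EFin \o (fun x => w x ord0 i * partial i phi x)).
Proof.
move=> lw; have mO := open_measurable_rV Omega_open.
have [M M0 /(Linfty_norm_leP _ _ M0) wM] := Linfty_norm_bound lw.
have ip := integrable_partial phi i.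
have mp : measurable_fun Omega (partial i phi).
  by apply/measurable_EFinP; exact: (measurable_int mu ip).
have mwp : measurable_fun Omega (fun x => w x ord0 i * partial i phi x).
  by apply: measurable_funM => //; exact: Linfty_coord.
apply/integrableP; split; first exact/measurable_EFinP.
have /integrableP[_] := integrableZl mO M ip.
apply: le_lt_trans; apply: ae_ge0_le_integral => //.
- exact/measurableT_comp/measurable_EFinP.
- apply: measurableT_comp => //; apply: measurable_funeM.
  exact/measurable_EFinP.
apply: filterS wM => x wM Ox; rewrite /= lee_fin !normrM ler_wpM2r//.
rewrite (ger0_norm M0) (le_trans _ (wM Ox))//; exact: le_coord_euclidean.
Qed.

Lemma divE w phi : Linfty Omega w ->
  div w phi = - \sum_i \int[mu]_(x in Omega) (w x ord0 i * partial i phi x).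
Proof.
move=> lw; congr (- _); rewrite /Rintegral sum_fine; last first.
  move=> i _; apply: integrable_fin_num; last exact: integrable_div.
  exact: open_measurable_rV.
rewrite -integral_sum.
- by under eq_integral do rewrite -sumEFin.
- exact: open_measurable_rV.
- by move=> i; exact: integrable_div.
Qed.

(** The L^1 norm of grad [phi] for the l^1 norm on R^d: the continuity constant of the divergence
    tested on [phi]. *)
Definition grad_mass phi := \sum_i \int[mu]_(x in Omega) `|partial i phi x|.

Lemma le_div w phi (M : R) : Linfty Omega w -> 0 <= M ->
  (Linfty_norm Omega w <= M%:E)%E -> `|div w phi| <= M * grad_mass phi.
Proof.
move=> lw M0 /(Linfty_norm_leP _ _ M0) wM.
have mO := open_measurable_rV Omega_open.
rewrite divE// normrN mulr_sumr; apply: le_trans (ler_norm_sum _ _ _) _.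
apply: ler_sum => i _; have iw := integrable_div phi i lw.
have ip := integrable_norm (integrable_partial phi i).
apply: le_trans (le_normr_Rintegral mO iw) _.
rewrite -RintegralZl//; apply: fine_le.
- by apply: integrable_fin_num => //; exact: (integrable_norm iw).
- by apply: integrable_fin_num => //; exact: (integrableZl mO M ip).
apply: ae_ge0_le_integral => //.
- exact: (measurable_int mu (integrable_norm iw)).
- by move=> x _; rewrite lee_fin mulr_ge0.
- exact: (measurable_int mu (integrableZl mO M ip)).
apply: filterS wM => x wM Ox; rewrite /= lee_fin !normrM ler_wpM2r//.
by rewrite (le_trans _ (wM Ox))// le_coord_euclidean.
Qed.

Lemma div0 phi : div 0 phi = 0.
Proof.
apply/normr0_eq0/le_anti; rewrite normr_ge0 andbT -(mul0r (grad_mass phi)).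
by apply: le_div => //; [exact: Linfty0|rewrite Linfty_norm0].
Qed.

Lemma divD v w : Linfty Omega v -> Linfty Omega w ->
  div (v + w) = div v \+ div w :> (testfun Omega -> R).
Proof.
move=> lv lw; apply/funext => phi /=; have mO := open_measurable_rV Omega_open.
rewrite !divE//; last exact: LinftyD.
rewrite -opprD -big_split/=; congr (- _); apply: eq_bigr => i _.
rewrite -RintegralD//; [|exact: integrable_div..].
by apply: eq_Rintegral => x _; rewrite mxE mulrDl.
Qed.

Lemma divN w : Linfty Omega w -> div (- w) = \- div w :> (testfun Omega -> R).
Proof.
move=> lw; apply/funext => phi /=; have mO := open_measurable_rV Omega_open.
rewrite !divE//; last exact: LinftyN.
congr (- _); rewrite -sumrN; apply: eq_bigr => i _.
rewrite -mulN1r -RintegralZl//; last exact: integrable_div.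
by apply: eq_Rintegral => x _; rewrite mxE mulN1r mulNr.
Qed.

End divergence.

(** * The dual norm and one minimization step *)

Section dual_norm_theory.
Variables (R : realType) (d : nat) (Omega : set 'rV[R]_d).
Variables (Z : normedModType R) (iota : {linear testfun Omega -> Z}).
Implicit Types v w : testfun Omega -> R.

Lemma dual_norm_ge0 v : dual iota v -> (0 <= dual_norm iota v)%E.
Proof.
move=> [l cl ->]; apply: ereal_sup_ubound; exists 0.
  by rewrite /= raddf0 normr0.
by rewrite /= !raddf0.
Qed.

Lemma dual_norm_lty v : dual iota v -> (dual_norm iota v < +oo)%E.
Proof.
move=> [l cl ->].
have /linear_boundedP/pinfty_ex_gt0[M M0 lM] :=
  continuous_linear_bounded 0 (cl 0).
apply: (@le_lt_trans _ _ M%:E); last exact: ltry.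
apply: ge_ereal_sup => _ [phi phi1 <-]; rewrite lee_fin.
apply: le_trans (ler_norm _) _; apply: le_trans (lM _) _.
by rewrite ler_piMr// ltW.
Qed.

Lemma dual_norm_fin_num v : dual iota v -> dual_norm iota v \is a fin_num.
Proof. by move=> dv; rewrite ge0_fin_numE ?dual_norm_ge0// dual_norm_lty. Qed.

(** [dual_norm] is a supremum of signed values; testing with [phi] divided by its norm, under either
    sign, recovers the absolute value. *)
Lemma le_dual_norm v phi : dual iota v ->
  `|v phi| <= fine (dual_norm iota v) * `|iota phi|.
Proof.
move=> dv; have fv := dual_norm_fin_num dv; case: (dv) => l cl vE.
(* Normalization fails here, but [v] factors through [iota] and so vanishes at [phi]. *)
have [phi0|phi0] := eqVneq `|iota phi| 0.
  by rewrite vE /= (normr0_eq0 phi0) raddf0 !normr0 mulr0.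
have phi_gt0 : 0 < `|iota phi| by rewrite lt_def phi0 normr_ge0.
rewrite -ler_pdivrMr//.
have H (s : R) : `|s| = 1 -> s * v phi / `|iota phi| <= fine (dual_norm iota v).
  move=> s1; rewrite -lee_fin fineK//; apply: ereal_sup_ubound.
  exists ((s / `|iota phi|) *: phi) => /=.
    by rewrite linearZ normrZ normrM s1 mul1r normfV normr_id mulVf.
  by rewrite vE /= !linearZ /= /GRing.scale/= mulrAC.
have [_|_] := ger0P (v phi).
  by have := H 1 (normr1 _); rewrite mul1r.
by have := H (-1) (normrN1 _); rewrite mulN1r.
Qed.

Lemma dualB v w : dual iota v -> dual iota w -> dual iota (v \- w).
Proof.
move=> [l cl ->] [k ck ->]; exists (l \- k)%R => //.
by move=> x; apply: cvgB; [exact: cl|exact: ck].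
Qed.

Lemma dual_norm0 : dual_norm iota (cst 0) = 0%E.
Proof.
rewrite /dual_norm (_ : [set _ | _ in _] = [set 0%E]) ?ereal_sup1//.
apply/seteqP; split=> [_ [phi _ <-]//|_ ->]; exists 0 => //.
by rewrite /= raddf0 normr0.
Qed.

(** The competitor [w] leaves no residual, so its functional is its norm alone, which is finite.
    Minimality makes the functional finite at [u] as well, and this puts [div u] in the dual. *)
Lemma minimizer_step (gamma lambda : R) v (u : 'rV[R]_d -> 'rV[R]_d) :
  0 < lambda -> dual iota v ->
  (exists w : 'rV[R]_d -> 'rV[R]_d, [/\ Linfty Omega w, div w = v &
     (Linfty_norm Omega w <= gamma%:E * dual_norm iota v)%E]) ->
  minimizer Omega (functional iota lambda v) u ->
  dual iota (div u) /\
  (Linfty_norm Omega u + lambda%:E * dual_norm iota (v \- div u)%R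
    <= gamma%:E * dual_norm iota v)%E.
Proof.
move=> l0 dv [w [lw wv wle]] [lu /(_ w lw)].
rewrite {2}/functional wv asboolT//.
rewrite (_ : v \- v = cst 0) ?dual_norm0 ?mule0 ?adde0; last first.
  by apply/funext => phi; rewrite /= subrr.
rewrite /functional; case: asboolP => [du /le_trans/(_ wle)//|_].
by rewrite leye_eq => /eqP wy; move: lw => [_]; rewrite wy.
Qed.

End dual_norm_theory.

(** * Series of fields dominated by a convergent series *)

Section Linfty_series.
Variables (R : realType) (d : nat) (Omega : set 'rV[R]_d).
Variables (u : nat -> 'rV[R]_d -> 'rV[R]_d) (c : R^nat).
Hypothesis lu : forall j, Linfty Omega (u j).
Hypothesis uc : forall j, (Linfty_norm Omega (u j) <= (c j)%:E)%E.
Hypothesis cvgc : cvgn (series c).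
Local Notation mu := (lebesgue_rV R d).

Let c_ge0 j : 0 <= c j.
Proof. by rewrite -lee_fin (le_trans _ (uc j))// Linfty_norm_ge0. Qed.

(** Countably many null sets are merged into one, so that all the bounds hold together at almost
    every point. *)
Let ae_uc : {ae mu, forall x, forall j, Omega x -> euclidean (u j x) <= c j}.
Proof. by apply: ae_foralln => j; exact/Linfty_norm_leP. Qed.

Lemma Linfty_sum n : Linfty Omega (\sum_(0 <= j < n) u j).
Proof.
elim/big_ind: _ => // [|v w]; [exact: Linfty0|exact: LinftyD].
Qed.

(* The upper limit makes the coordinates measurable everywhere, although the
   series converges only almost everywhere. *)
Definition Linfty_series_sum : 'rV[R]_d -> 'rV[R]_d := fun x =>
  \row_i fine (limn_esup (fun n => (\sum_(0 <= j < n) u j x ord0 i)%:E)).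

(** The difference is a block of the series, bounded by the same block of [c] and hence by the full
    tail of [c]. The bound is independent of [m], which may then tend to infinity. *)
Let euclidean_tail x m n : (forall j, euclidean (u j x) <= c j) -> (n <= m)%N ->
  euclidean (\sum_(0 <= j < n) u j x - \sum_(0 <= j < m) u j x)
    <= limn (series c) - series c n.
Proof.
move=> ux nm; rewrite -opprB euclideanN (big_cat_nat (leq0n n) nm)/=.
rewrite addrAC subrr add0r.
apply: (@le_trans _ _ (\sum_(n <= j < m) c j)).
  elim/big_ind2: _ => // [|v a w b va wb]; first by rewrite euclidean0.
  by apply: le_trans (euclideanD _ _) _; exact: lerD.
rewrite -sub_series_geq// lerD2r; apply: nondecreasing_cvgn_le => //.
exact: nondecreasing_series.
Qed.

(** Where all the bounds hold, each coordinate series converges absolutely, so the upper limit is a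
    finite limit and [fine] loses nothing. *)
Let cvg_coord x i : (forall j, euclidean (u j x) <= c j) ->
  \sum_(0 <= j < n) u j x ord0 i @[n --> \oo] --> Linfty_series_sum x ord0 i.
Proof.
move=> ux; have cu : cvgn (series (fun j => u j x ord0 i)).
  apply: normed_cvg; apply: (series_le_cvg _ c_ge0 _ cvgc) => [j|j]/=.
    exact: normr_ge0.
  by apply: le_trans (ux j); exact: le_coord_euclidean.
rewrite mxE; set s := (X in limn_esup X).
have sl : s @ \oo --> (limn (series (fun j => u j x ord0 i)))%:E.
  by apply: cvg_EFin => //; exact: nearW.
rewrite is_cvg_limn_esupE; last by apply/cvg_ex; eexists; exact: sl.
by rewrite (cvg_lim _ sl).
Qed.

Lemma Linfty_series_sum_tail n :
  (Linfty_norm Omega (\sum_(0 <= j < n) u j - Linfty_series_sum)%R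
    <= (limn (series c) - series c n)%:E)%E.
Proof.
have t0 : 0 <= limn (series c) - series c n.
  rewrite subr_ge0; apply: nondecreasing_cvgn_le => //.
  exact: nondecreasing_series.
apply/Linfty_norm_leP => //; apply: filterS ae_uc => x ux Ox.
have {}ux j : euclidean (u j x) <= c j by exact: ux.
rewrite euclidean_le//.
(* With squared norms the passage to the limit in [m] reduces to sums and squares of coordinates. *)
have S : \sum_i ((\sum_(0 <= j < n) u j) x ord0 i -
      \sum_(0 <= j < m) u j x ord0 i) ^+ 2 @[m --> \oo] -->
    \sum_i (\sum_(0 <= j < n) u j - Linfty_series_sum) x ord0 i ^+ 2.
  apply: cvg_big => // [|i _]; first by move=> z; exact: add_continuous.
  have -> : (\sum_(0 <= j < n) u j - Linfty_series_sum) x ord0 i =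
      (\sum_(0 <= j < n) u j) x ord0 i - Linfty_series_sum x ord0 i.
    by rewrite mxE [X in _ + X]mxE.
  apply: (@cvg_comp _ _ _ _ (fun y : R => y ^+ 2)); last first.
    exact: exprn_continuous.
  by apply: cvgB; [exact: cvg_cst|exact: cvg_coord].
apply: (cvgr_to_le S); near=> m.
have nm : (n <= m)%N by near: m; exact: nbhs_infty_ge.
have := euclidean_tail ux nm; rewrite euclidean_le//; apply: le_trans.
rewrite le_eqVlt; apply/orP; left; apply/eqP; apply: eq_bigr => i _.
by rewrite !mxE !summxE fct_sumE summxE.
Unshelve. all: by end_near. Qed.

(** This is the tail estimate at [n = 0], where the partial sum is empty. *)
Lemma Linfty_series_sum_bound :
  (Linfty_norm Omega Linfty_series_sum <= (limn (series c))%:E)%E.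
Proof.
have := Linfty_series_sum_tail 0.
by rewrite big_geq// add0r Linfty_normN /series/= big_geq// subr0.
Qed.

Lemma Linfty_Linfty_series_sum : Linfty Omega Linfty_series_sum.
Proof.
split; last by apply: le_lt_trans Linfty_series_sum_bound _; exact: ltry.
apply: measurable_fun_rV => i; under eq_fun do rewrite mxE.
apply: measurableT_comp => //; apply: measurable_fun_limn_esup => n.
apply/measurable_EFinP/measurable_sum => j; exact: Linfty_coord.
Qed.

End Linfty_series.

(** * Decay of the residuals and the limit field *)

Theorem mainTheorem8 (R : realType) (d : nat) (hd : (2 <= d)%N)
  (Omega : set 'rV[R]_d) (Omega_neq0 : Omega !=set0) (Omega_open : open Omega)
  (Omega_connected : connected Omega)
  (Z : normedModType R) (iota : {linear testfun Omega -> Z})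
  (hiota : test_embedding iota)
  (gamma : R) (gamma_gt0 : 0 < gamma)
  (solvable : forall g, dual iota g ->
     exists u, [/\ Linfty Omega u, div u = g &
       (Linfty_norm Omega u <= gamma%:E * dual_norm iota g)%E])
  (lambda : R) (gamma_lt_lambda : gamma < lambda)
  (f : testfun Omega -> R) (hf : dual iota f)
  (u : nat -> 'rV[R]_d -> 'rV[R]_d) (r : nat -> testfun Omega -> R)
  (r0 : r 0%N = f)
  (u_min : forall j, (1 <= j)%N ->
     minimizer Omega (functional iota lambda (r j.-1)) (u j))
  (rS : forall j, (1 <= j)%N -> r j = r j.-1 \- div (u j)) :
  let rho := gamma / lambda in
  (forall j, (1 <= j)%N ->
     [/\ dual iota (r j),
         (dual_norm iota (r j) <= (rho ^+ j)%:E * dual_norm iota f)%E &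
         (Linfty_norm Omega (u j)
            <= (gamma * rho ^+ j.-1)%:E * dual_norm iota f)%E]) /\
  exists U : 'rV[R]_d -> 'rV[R]_d,
    [/\ Linfty Omega U,
        Linfty_norm Omega (\sum_(1 <= j < n.+1) u j - U) @[n --> \oo] --> 0%E,
        div U = f &
        (Linfty_norm Omega U <= (gamma / (1 - rho))%:E * dual_norm iota f)%E].
Proof.
move=> rho.
have lambda_gt0 : 0 < lambda by exact: lt_trans gamma_lt_lambda.
have rho_gt0 : 0 < rho by exact: divr_gt0.
have rho_lt1 : rho < 1 by rewrite ltr_pdivrMr// mul1r.
(* The fields are numbered from 1 and [u 0] is arbitrary, hence the shift to [u j.+1] throughout. *)
have lu j : Linfty Omega (u j.+1) by have [] := u_min j.+1 isT.
have fF := dual_norm_fin_num hf.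
set F := fine (dual_norm iota f).
have F0 : 0 <= F by rewrite fine_ge0// dual_norm_ge0.
have FE : dual_norm iota f = F%:E by rewrite fineK.
have step j : dual iota (r j) ->
    [/\ dual iota (r j.+1),
       fine (dual_norm iota (r j.+1)) <= rho * fine (dual_norm iota (r j)) &
       (Linfty_norm Omega (u j.+1)
          <= (gamma * fine (dual_norm iota (r j)))%:E)%E].
  move=> dr.
  have [du] := minimizer_step lambda_gt0 dr (solvable _ dr) (u_min j.+1 isT).
  rewrite -/(r j) -(rS j.+1)//.
  have dS : dual iota (r j.+1) by rewrite rS//; exact: dualB.
  have u0 := Linfty_norm_ge0 Omega (u j.+1).
  have uF : Linfty_norm Omega (u j.+1) \is a fin_num.
    by have [_ uy] := lu j; rewrite ge0_fin_numE.
  rewrite -(fineK (dual_norm_fin_num dr)) -(fineK (dual_norm_fin_num dS)).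
  rewrite -(fineK uF).
  rewrite -!EFinM -EFinD !lee_fin /=.
  (* Both terms on the left of the step inequality are nonnegative: dropping the field norm gives
     the contraction by [rho], dropping the residual gives the bound on the field. *)
  have := fine_ge0 u0; have := fine_ge0 (dual_norm_ge0 dS).
  move=> b0 a0 ab; split=> //.
    rewrite /rho mulrAC ler_pdivlMr// mulrC; apply: le_trans ab.
    by rewrite lerDr.
  by apply: le_trans ab; rewrite lerDl mulr_ge0// ltW.
have rP j : dual iota (r j) /\ fine (dual_norm iota (r j)) <= rho ^+ j * F.
  elim: j => [|j [dr rj]]; first by rewrite r0 expr0 mul1r.
  have [dS rS' _] := step j dr; split=> //.
  by apply: le_trans rS' _; rewrite exprS -mulrA ler_pM2l.
(* Induction on the residuals yields the dominating series, with first term [gamma * F] and ratio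
   [rho]. *)
have uP j : (Linfty_norm Omega (u j.+1) <= (geometric (gamma * F) rho j)%:E)%E.
  have [dr rj] := rP j; have [_ _ uj] := step j dr.
  apply: le_trans uj _; rewrite lee_fin /= -mulrA ler_pM2l// mulrC.
  by rewrite mulrC [F * _]mulrC.
have rho_norm : `|rho| < 1 by rewrite gtr0_norm.
have cc := @cvg_geometric_series _ (gamma * F) _ rho_norm.
have cvgc := @is_cvg_geometric_series _ (gamma * F) _ rho_norm.
split=> [[//|j] _|].
  have [dr rj] := rP j.+1; split=> //.
    by rewrite FE -EFinM -(fineK (dual_norm_fin_num dr)) lee_fin.
  by apply: le_trans (uP j) _; rewrite FE -EFinM lee_fin /= mulrAC.
pose U := Linfty_series_sum (fun j => u j.+1).
have lU : Linfty Omega U by exact: (Linfty_Linfty_series_sum lu uP cvgc).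
have tail := Linfty_series_sum_tail uP cvgc.
have sumE n : \sum_(1 <= j < n.+1) u j = \sum_(0 <= j < n) u j.+1.
  by rewrite big_add1.
have tail0 : limn (series (geometric (gamma * F) rho)) -
    series (geometric (gamma * F) rho) n @[n --> \oo] --> (0 : R).
  rewrite -(subrr (limn (series (geometric (gamma * F) rho)))).
  by apply: cvgB; [exact: cvg_cst|exact: cvgc].
exists U; split=> //.
- apply: (@squeeze_cvge _ _ _ _ (cst 0%E) _ (fun n =>
    (limn (series (geometric (gamma * F) rho)) -
     series (geometric (gamma * F) rho) n)%:E)).
  + by apply: nearW => n; rewrite Linfty_norm_ge0 sumE tail.
  + exact: cvg_cst.
  + by apply: cvg_EFin => //; exact: nearW.
(* For a fixed [phi], the defect of [div U] from [f] is bounded by a null sequence: the tail of the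
   series times [grad_mass phi], plus the residual tested on [phi]. *)
- apply/funext => phi; apply/eqP; rewrite -subr_eq0 -normr_le0.
  have divS n : div (\sum_(0 <= j < n) u j.+1) phi = f phi - r n phi.
    elim: n => [|n IHn].
      by rewrite big_geq// r0 subrr div0.
    rewrite big_nat_recr//= divD//; last exact: Linfty_sum.
    by rewrite /= IHn (rS n.+1)//=; ring.
  have bound n : `|div U phi - f phi| <=
     (limn (series (geometric (gamma * F) rho)) -
      series (geometric (gamma * F) rho) n) * grad_mass phi +
      rho ^+ n * F * `|iota phi|.
    have lS := Linfty_sum lu n; have [dr rn] := rP n.
    (* The n-th partial sum has divergence [f - r n], which is inserted between [div U] and [f]. *)
    have -> : div U phi - f phi =
        - (div (\sum_(0 <= j < n) u j.+1 - U) phi + r n phi).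
      by rewrite divD ?divN//=; [rewrite divS; ring|exact: LinftyN].
    rewrite normrN; apply: le_trans (ler_normD _ _) (lerD _ _).
      apply: le_div => //; first by apply: LinftyD => //; exact: LinftyN.
      by rewrite -lee_fin (le_trans _ (tail n))// Linfty_norm_ge0.
    by apply: le_trans (le_dual_norm _ dr) _; rewrite ler_wpM2r.
  have : (limn (series (geometric (gamma * F) rho)) -
      series (geometric (gamma * F) rho) n) * grad_mass phi +
      rho ^+ n * F * `|iota phi| @[n --> \oo]
      --> 0 * grad_mass phi + 0 * F * `|iota phi|.
    apply: cvgD; first by apply: cvgMr_tmp; exact: tail0.
    by do 2 apply: cvgMr_tmp; exact: cvg_expr.
  (* The defect does not depend on [n], so it is at most the limit 0. *)
  rewrite !mul0r addr0 => /cvgr_to_ge; apply; exact: nearW.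
rewrite FE -EFinM.
(* The geometric series sums to [gamma * F / (1 - rho)], the required constant. *)
apply: le_trans (Linfty_series_sum_bound uP cvgc) _.
by rewrite (cvg_lim _ cc)// lee_fin mulrAC.
Qed.
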